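(* Let $\mathcal{A}$ be a finite alphabet, $T=\mathcal{A}^{<\mathbb{N}}$, $Z\subseteq T$, and $W=\bigcup_{p\in Z}[T_p]$. Let $\tilde T=\mathrm{Sch}(\langle\rangle)$ be the tree of reduced words of the free group $F(\mathcal{A})$. Then $\tilde T$ provides a covering of $(T,W)$: there exist maps $\pi,\varphi_1,\varphi_2$ such that $(\tilde T,\pi,\varphi_1,\varphi_2)$ is a covering of $T$, and in this covering $$\pi^{-1}(W)=\bigcup_{p=\langle a_1,\dots,a_n\rangle\in Z}\ \bigcup_{\epsilon_1,\dots,\epsilon_n\in\{\pm1\}}\bigl[\tilde T_{\langle a_1^{\epsilon_1},\dots,a_n^{\epsilon_n}\rangle}\bigr],$$ where the inner union is taken only over those $(\epsilon_1,\dots,\epsilon_n)$ for which no reduction (segment of the form $aa^{-1}$ or $a^{-1}a$) appears in $a_1^{\epsilon_1}\cdots a_n^{\epsilon_n}$.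
   Context: A tree over an alphabet is a nonempty set of finite sequences (positions) closed under prefixes and in which each element is a strict prefix of another element. For a tree $T$, $[T]$ is the set of infinite sequences (plays) all of whose finite prefixes lie in $T$, and $[T_p]$ is the set of plays in $[T]$ having $p$ as a prefix. In a game on $T$, Player 1 moves at positions of even length and Player 2 at positions of odd length; a strategy of Player 1 (Player 2) is a function assigning to each position of even (odd) length an action keeping the position in the tree. $S_i(T)$ is the set of strategies of Player $i$; a play is consistent with a strategy $s_i$ if it results from $s_i$ and some strategy of the other player. Here $\mathcal{A}^{<\mathbb{N}}$ is the set of all finite sequences over $\mathcal{A}$. $\mathrm{Sch}(\langle\rangle)$, the Schreier graph of the trivial subgroup (the Cayley graph of $F(\mathcal{A})$), is regarded as the tree over the alphabet $\mathcal{A}\cup\mathcal{A}^{-1}$ whose positions are the finite sequences $\langle a_1^{\epsilon_1},\dots,a_n^{\epsilon_n}\rangle$ ($a_i\in\mathcal{A}$, $\epsilon_i\in\{\pm1\}$) that are reduced, i.e. contain no segment $aa^{-1}$ or $a^{-1}a$. A covering of a tree $T$ is a quadruple $(\tilde T,\pi,\varphi_1,\varphi_2)$ where $\tilde T$ is a tree, $\pi:\tilde T\to T$ and $\varphi_i:S_i(\tilde T)\to S_i(T)$ ($i=1,2$) are maps such that: (1) $\mathrm{len}(\pi(\tilde p))=\mathrm{len}(\tilde p)$ for all $\tilde p\in\tilde T$, and if $\tilde p$ is a prefix of $\tilde p'$ then $\pi(\tilde p)$ is a prefix of $\pi(\tilde p')$ (so $\pi$ induces a map $[\tilde T]\to[T]$,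 also denoted $\pi$); (2) for $i=1,2$, every $n\in\mathbb{N}$ and $\tilde s_i,\tilde s_i'\in S_i(\tilde T)$, if $\tilde s_i$ and $\tilde s_i'$ agree on all positions of length at most $n$, then $\varphi_i(\tilde s_i)$ and $\varphi_i(\tilde s_i')$ agree on all positions of $T$ of length at most $n$; (3) for $i=1,2$ and every $\tilde s_i\in S_i(\tilde T)$, if a play $x\in[T]$ is consistent with $\varphi_i(\tilde s_i)$, then there is a play $\tilde x\in[\tilde T]$ consistent with $\tilde s_i$ with $\pi(\tilde x)=x$. *)

(* Defs.v *)
From mathcomp Require Import all_boot all_classical.
Set Implicit Arguments.
Unset Strict Implicit.
Unset Printing Implicit Defensive.
Local Open Scope classical_set_scope.

Record tree (X : eqType) := Tree {
  tree_set : set (seq X);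
  tree_nonempty : tree_set !=set0;
  tree_prefix : forall p q, tree_set q -> prefix p q -> tree_set p;
  tree_pruned : forall p, tree_set p ->
    exists q, [/\ tree_set q, prefix p q & p != q] }.

Definition position (X : eqType) (T : tree X) := {p : seq X | tree_set T p}.

(* The play [x] is the infinite sequence [x 0, x 1, ...]; [mkseq x n] is its
   prefix of length [n]. *)
Definition play (X : eqType) (T : tree X) :=
  {x : nat -> X | forall n, tree_set T (mkseq x n)}.

Definition play_pos (X : eqType) (T : tree X) (x : play T) (n : nat) :
  position T := exist _ (mkseq (sval x) n) (svalP x n).

Definition plays_through (X : eqType) (T : tree X) (p : seq X) : set (play T) :=
  [set x | mkseq (sval x) (size p) = p].
Arguments plays_through {X} T p.

Variant player := player1 | player2.

Definition opponent (i : player) : player :=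
  if i is player1 then player2 else player1.

Definition moves_at (i : player) (n : nat) : bool :=
  if i is player1 then ~~ odd n else odd n.

Definition turn (X : eqType) (T : tree X) (i : player) :=
  {p : seq X | tree_set T p /\ moves_at i (size p)}.

Definition strategy (X : eqType) (T : tree X) (i : player) :=
  {s : turn T i -> X | forall p, tree_set T (rcons (sval p) (s p))}.

Definition follows (X : eqType) (T : tree X) (i : player)
    (s : strategy T i) (x : play T) : Prop :=
  forall p : turn T i, plays_through T (sval p) x ->
    sval x (size (sval p)) = sval s p.

(* [x] results from [s] and [t] when it follows both. *)
Definition consistent (X : eqType) (T : tree X) (i : player)
    (s : strategy T i) (x : play T) : Prop :=
  exists t : strategy T (opponent i), follows s x /\ follows t x.

Definition agree_upto (X : eqType) (T : tree X) (i : player) (n : nat)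
    (s s' : strategy T i) : Prop :=
  forall p : turn T i, size (sval p) <= n -> sval s p = sval s' p.

Record tree_map (X Y : eqType) (T' : tree X) (T : tree Y) := TreeMap {
  pos_map :> position T' -> position T;
  pos_map_size : forall p, size (sval (pos_map p)) = size (sval p);
  pos_map_prefix : forall p q, prefix (sval p) (sval q) ->
    prefix (sval (pos_map p)) (sval (pos_map q)) }.

Section InducedMap.
Variables (X Y : eqType) (T' : tree X) (T : tree Y) (f : tree_map T' T).

Lemma induced_lt (x : play T') (n : nat) :
  n < size (sval (f (play_pos x n.+1))).
Proof. by rewrite pos_map_size size_mkseq. Qed.

(* The [n]-th letter of the image of [x] is the last letter of the image of the
   prefix of [x] of length [n.+1]. *)
Definition induced_fun (x : play T') (n : nat) : Y :=
  tnth (in_tuple (sval (f (play_pos x n.+1)))) (Ordinal (induced_lt x n)).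

Lemma mkseq_induced_fun (x : play T') (n : nat) :
  mkseq (induced_fun x) n = sval (f (play_pos x n)).
Proof.
have sz m : size (sval (f (play_pos x m))) = m.
  by rewrite pos_map_size size_mkseq.
have [y0|noY] := pselect (exists y : Y, True); last first.
  case: n => [|n]; first by rewrite (size0nil (sz 0)).
  by exfalso; apply: noY; exists (induced_fun x 0).
case: y0 => y0 _; apply: (@eq_from_nth _ y0); rewrite size_mkseq ?sz // => k kn.
rewrite nth_mkseq // /induced_fun (tnth_nth y0) /=.
have pk : prefix (sval (play_pos x k.+1)) (sval (play_pos x n)).
  by rewrite /= prefixE size_mkseq /mkseq -map_take take_iota (minn_idPl kn).
have /prefixP[s ->] := @pos_map_prefix _ _ _ _ f _ _ pk.
by rewrite nth_cat sz ltnSn.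
Qed.

Lemma induced_fun_in (x : play T') (n : nat) :
  tree_set T (mkseq (induced_fun x) n).
Proof. by rewrite mkseq_induced_fun; exact: svalP. Qed.

Definition induced (x : play T') : play T :=
  exist (fun y : nat -> Y => forall n, tree_set T (mkseq y n))
    (induced_fun x) (induced_fun_in x).

End InducedMap.

Record covering (X Y : eqType) (T' : tree X) (T : tree Y) := Covering {
  cov_pi : tree_map T' T;
  cov_phi : forall i : player, strategy T' i -> strategy T i;
  cov_local : forall (i : player) (n : nat) (s s' : strategy T' i),
    agree_upto n s s' -> agree_upto n (cov_phi s) (cov_phi s');
  cov_lift : forall (i : player) (s : strategy T' i) (x : play T),
    consistent (cov_phi s) x ->
    exists x' : play T', consistent s x' /\ induced cov_pi x' = x }.

Lemma full_tree_pruned (A : finType) (hA : 0 < #|A|) (p : seq A) :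
  [set: seq A] p -> exists q, [/\ [set: seq A] q, prefix p q & p != q].
Proof.
move=> _; have /card_gt0P[a _] := hA; exists (rcons p a); split => //.
  by rewrite -cats1 prefix_prefix.
by apply/eqP => /(congr1 size)/eqP; rewrite size_rcons ltn_eqF.
Qed.

Definition full_tree (A : finType) (hA : 0 < #|A|) : tree A :=
  @Tree A [set: seq A] (ex_intro _ [::] I) (fun p q _ _ => I)
    (full_tree_pruned hA).

(* The letter a^+1 is [(a, true)] and the letter a^-1 is [(a, false)]. *)
Definition reduced (A : finType) (w : seq (A * bool)) : Prop :=
  forall (a : A) (e : bool), ~~ infix [:: (a, e); (a, ~~ e)] w.

Lemma reduced_nonempty (A : finType) : [set w | @reduced A w] !=set0.
Proof. by exists [::] => a e. Qed.

Lemma reduced_prefix (A : finType) (p q : seq (A * bool)) :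
  reduced q -> prefix p q -> reduced p.
Proof.
move=> rq pq a e; apply: contra (rq a e) => h.
exact: infix_trans h (prefixW pq).
Qed.

Lemma reduced_pruned (A : finType) (hA : 0 < #|A|) (p : seq (A * bool)) :
  reduced p -> exists q, [/\ reduced q, prefix p q & p != q].
Proof.
have /card_gt0P[a0 _] := hA => rp.
exists (rcons p (last (a0, true) p)); split; last first.
- by apply/eqP => /(congr1 size)/eqP; rewrite size_rcons ltn_eqF.
- by rewrite -cats1 prefix_prefix.
case/lastP: p rp => [|p c] rp a e; first by rewrite /= andbF.
rewrite last_rcons; apply/negP => /infixP[s [t E]].
case/lastP: t E => [|t d].
  rewrite cats0 -[[:: (a, e); _]]/([:: (a, e)] ++ [:: (a, ~~ e)]) catA !cats1.
  by move=> /rcons_inj[/rcons_inj[_ ->]] []; case: e.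
rewrite -!rcons_cat => /rcons_inj[E _].
by have /negP := rp a e; apply; apply/infixP; exists s, t.
Qed.

Definition reduced_tree (A : finType) (hA : 0 < #|A|) : tree (A * bool)%type :=
  Tree (@reduced_nonempty A) (@reduced_prefix A) (reduced_pruned hA).

(* Main.v *)
(* The map [pi] forgets exponents.  Given a strategy [s] of one player on reduced
   words, every word [p] over the alphabet is lifted letter by letter: where
   [s] proposes the actual next letter with some exponent, that exponent is
   taken; otherwise the exponent of the previous letter is repeated, which can
   never create a reduction.  The strategy induced on the full tree plays the
   letter that [s] plays at the lifted position, so the lift of a play following
   the induced strategy follows [s]. *)
Require Import Defs.
From mathcomp Require Import all_boot all_classical.
Local Open Scope classical_set_scope.

Lemma mkseq_inj (X : Type) (x y : nat -> X) :
  (forall n, mkseq x n = mkseq y n) -> x = y.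
Proof.
move=> xy; apply/funext => n; have := xy n.+1.
by rewrite !mkseqS => /rcons_inj[].
Qed.

Lemma map_mkseq (X Y : Type) (f : X -> Y) (x : nat -> X) (n : nat) :
  map f (mkseq x n) = mkseq (f \o x) n.
Proof. by rewrite /mkseq -map_comp. Qed.

Lemma prefix_map (X Y : eqType) (f : X -> Y) (p q : seq X) :
  prefix p q -> prefix (map f p) (map f q).
Proof. by case/prefixP => r ->; rewrite map_cat prefix_prefix. Qed.

Section TreeStrategies.
Set Implicit Arguments.
Unset Strict Implicit.
Variables (X : eqType) (T : tree X).

(** Pruning yields some strictly longer position; prefix closure cuts it back to one extra
    letter. *)
Lemma tree_extend (p : seq X) : tree_set T p -> exists c, tree_set T (rcons p c).
Proof.
move=> /tree_pruned[q [Tq /prefixP[[|c r] E] pq]].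
  by rewrite E cats0 eqxx in pq.
exists c; apply: tree_prefix Tq _.
by rewrite E -cat_rcons prefix_prefix.
Qed.

Lemma sval_inj (U : Type) (P : U -> Prop) (u v : {x | P x}) :
  sval u = sval v -> u = v.
Proof. by apply: (@eq_sig_hprop U P _ u v) => w p q; exact: Prop_irrelevance. Qed.

Variable i : player.

(** The opponent's strategy copies [x] at the positions on [x]; at all others, a legal letter is
    picked by choice. Consistency thus reduces to [follows]. *)
Lemma follows_consistent (s : strategy T i) (x : play T) :
  follows s x -> consistent s x.
Proof.
move=> sx.
have ext (p : turn T (opponent i)) : {c | tree_set T (rcons (sval p) c) /\
    (plays_through T (sval p) x -> sval x (size (sval p)) = c)}.
  apply: cid; have [xp|nxp] := pselect (plays_through T (sval p) x).
    exists (sval x (size (sval p))); split=> //.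
    by rewrite -{1}xp -mkseqS; exact: (svalP x).
  by have [Tp _] := svalP p; have [c Tc] := tree_extend Tp; exists c.
exists (exist (fun t : turn T (opponent i) -> X =>
    forall p, tree_set T (rcons (sval p) (t p)))
  (fun p => sval (ext p)) (fun p => proj1 (svalP (ext p)))).
by split=> // p; exact: (proj2 (svalP (ext p))).
Qed.

(** Extending a strategy to raw words, with [None] off its turns, lets lifts be defined by plain
    recursion, before they are known to be reduced. *)
Definition move (s : strategy T i) (p : seq X) : option X :=
  if pselect (tree_set T p /\ moves_at i (size p)) is left h
  then Some (sval s (exist _ p h)) else None.

Lemma move_turn (s : strategy T i) (p : turn T i) :
  move s (sval p) = Some (sval s p).
Proof.
rewrite /move; case: pselect => [h|]; last by case; exact: (svalP p).
by congr (Some (sval s _)); exact: sval_inj.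
Qed.

Lemma move_tree (s : strategy T i) (p : seq X) (c : X) :
  move s p = Some c -> tree_set T (rcons p c).
Proof. by rewrite /move; case: pselect => // h [<-]; exact: (svalP s). Qed.

Lemma agree_move (n : nat) (s s' : strategy T i) (p : seq X) :
  agree_upto n s s' -> size p <= n -> move s p = move s' p.
Proof.
by move=> ss' pn; rewrite /move; case: pselect => // h; congr Some; exact: ss'.
Qed.

End TreeStrategies.

Section Lift.
Set Implicit Arguments.
Unset Strict Implicit.
Variable A : finType.

(** The default [true] for the empty word is arbitrary: a one-letter word is always reduced. *)
Definition last_sign (w : seq (A * bool)) : bool := last true (map snd w).

(** A new reduction could only be formed by the last two letters, and these carry equal signs. *)
Lemma reduced_rcons_last_sign (w : seq (A * bool)) (a : A) :
  reduced w -> reduced (rcons w (a, last_sign w)).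
Proof.
move=> rw b e; rewrite infix_rconsl negb_or rw andbT.
apply/negP => /suffixP[u].
rewrite -[[:: (b, e); _]]/([:: (b, e)] ++ [:: (b, ~~ e)]) catA !cats1.
move=> /rcons_inj[->] _; rewrite /last_sign map_rcons last_rcons /=.
by case: e.
Qed.

Variable hA : 0 < #|A|.
Let T := full_tree hA.
Let T' := reduced_tree hA.

Definition forget_signs : tree_map T' T :=
  TreeMap (pos_map := fun p : position T' =>
      exist _ (map fst (sval p)) I : position T)
    (fun p => size_map fst (sval p))
    (fun p q => @prefix_map _ _ fst (sval p) (sval q)).

Lemma induced_forget_signs (x : play T') :
  sval (induced forget_signs x) = fst \o sval x.
Proof.
apply: mkseq_inj => n.
by rewrite [LHS](mkseq_induced_fun forget_signs x n) /= map_mkseq.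
Qed.

Section LiftStrategy.
Variables (i : player) (s : strategy T' i).

(** When [move s w] is [None], as on the opponent's turns, the default passes the test and the
    previous sign is repeated. *)
Definition lift_letter (w : seq (A * bool)) (a : A) : A * bool :=
  let c := odflt (a, last_sign w) (move s w) in
  if c.1 == a then c else (a, last_sign w).

Lemma lift_letter_fst (w : seq (A * bool)) (a : A) : (lift_letter w a).1 = a.
Proof. by rewrite /lift_letter; case: ifP => // /eqP. Qed.

Lemma reduced_lift_letter (w : seq (A * bool)) (a : A) :
  reduced w -> reduced (rcons w (lift_letter w a)).
Proof.
move=> rw; rewrite /lift_letter; case E: (move s w) => [c|] /=.
  by case: ifP => _; [exact: move_tree E | exact: reduced_rcons_last_sign].
by rewrite eqxx; exact: reduced_rcons_last_sign.
Qed.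

Definition lift_word (p : seq A) : seq (A * bool) :=
  foldl (fun w a => rcons w (lift_letter w a)) [::] p.

Lemma lift_word_rcons (p : seq A) (a : A) :
  lift_word (rcons p a) = rcons (lift_word p) (lift_letter (lift_word p) a).
Proof. exact: foldl_rcons. Qed.

Lemma size_lift_word (p : seq A) : size (lift_word p) = size p.
Proof.
by elim/last_ind: p => // p a IH; rewrite lift_word_rcons !size_rcons IH.
Qed.

Lemma reduced_lift_word (p : seq A) : reduced (lift_word p).
Proof.
elim/last_ind: p => [|p a IH]; first by [].
by rewrite lift_word_rcons; exact: reduced_lift_letter.
Qed.

Lemma lift_turn_subproof (p : turn T i) :
  tree_set T' (lift_word (sval p)) /\ moves_at i (size (lift_word (sval p))).
Proof.
by split; [exact: reduced_lift_word | rewrite size_lift_word; case: (svalP p)].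
Qed.

Definition lift_turn (p : turn T i) : turn T' i :=
  exist _ (lift_word (sval p)) (lift_turn_subproof p).

Definition project_strategy : strategy T i :=
  exist (fun t : turn T i -> A => forall p, tree_set T (rcons (sval p) (t p)))
    (fun p => (sval s (lift_turn p)).1) (fun=> I).

Definition lift_fun (x : nat -> A) (n : nat) : A * bool :=
  lift_letter (lift_word (mkseq x n)) (x n).

Lemma mkseq_lift_fun (x : nat -> A) (n : nat) :
  mkseq (lift_fun x) n = lift_word (mkseq x n).
Proof. by elim: n => // n IH; rewrite !mkseqS lift_word_rcons IH. Qed.

Lemma lift_fun_reduced (x : nat -> A) (n : nat) :
  tree_set T' (mkseq (lift_fun x) n).
Proof. by rewrite mkseq_lift_fun; exact: reduced_lift_word. Qed.

Definition lift_play (x : play T) : play T' :=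
  exist (fun y : nat -> A * bool => forall n, tree_set T' (mkseq y n))
    (lift_fun (sval x)) (lift_fun_reduced (sval x)).

Lemma induced_lift_play (x : play T) : induced forget_signs (lift_play x) = x.
Proof.
apply: sval_inj; rewrite induced_forget_signs.
by apply/funext => n; exact: lift_letter_fst.
Qed.

(** A turn [q] on the lifted play is the lift of the prefix of [x] of the same length. There [x]
    plays the letter of [s] at [q] without its sign, so the test in [lift_letter] succeeds and
    restores the sign chosen by [s]. *)
Lemma follows_lift_play (x : play T) :
  follows project_strategy x -> follows s (lift_play x).
Proof.
move=> sx q; rewrite /plays_through /= mkseq_lift_fun => xq.
set n := size (sval q) in xq *.
have hp : tree_set T (mkseq (sval x) n) /\ moves_at i (size (mkseq (sval x) n)).
  by rewrite size_mkseq; split=> //; case: (svalP q).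
have := sx (exist _ _ hp); rewrite /plays_through /= !size_mkseq => /(_ erefl).
rewrite (_ : lift_turn _ = q); last exact: sval_inj.
by rewrite /lift_fun xq /lift_letter move_turn /= => ->; rewrite eqxx.
Qed.

End LiftStrategy.

(** Lifting [p] consults the strategy only at lifts of proper prefixes of [p], and lifting preserves
    length. *)
Lemma agree_lift_word (i : player) (n : nat) (s s' : strategy T' i) (p : seq A) :
  agree_upto n s s' -> size p <= n -> lift_word s p = lift_word s' p.
Proof.
move=> ss'; elim/last_ind: p => // p a IH; rewrite size_rcons => pn.
rewrite !lift_word_rcons -IH ?(ltnW pn)// /lift_letter.
by rewrite (agree_move ss') // size_lift_word ltnW.
Qed.

Lemma project_strategy_local (i : player) (n : nat) (s s' : strategy T' i) :
  agree_upto n s s' -> agree_upto n (project_strategy s) (project_strategy s').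
Proof.
move=> ss' p pn /=.
rewrite (_ : lift_turn s' p = lift_turn s p).
  by rewrite ss' //= size_lift_word.
by apply: sval_inj; rewrite /= (agree_lift_word ss').
Qed.

Lemma project_strategy_lift (i : player) (s : strategy T' i) (x : play T) :
  consistent (project_strategy s) x ->
  exists x' : play T', consistent s x' /\ induced forget_signs x' = x.
Proof.
(* The opponent's strategy on [T] is dropped; one on [T'] is rebuilt from the lifted play. *)
move=> [_ [sx _]]; exists (lift_play s x); split.
  by apply: follows_consistent; exact: follows_lift_play.
exact: induced_lift_play.
Qed.

Definition free_covering : covering T' T :=
  Covering project_strategy_local project_strategy_lift.

Lemma plays_through_forget_signs (p : seq A) :
  induced forget_signs @^-1` plays_through T p =
  \bigcup_(e in [set e : (size p).-tuple bool | reduced (zip p e)])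
    plays_through T' (zip p e).
Proof.
have through x : plays_through T p (induced forget_signs x) =
    (map fst (mkseq (sval x) (size p)) = p).
  by rewrite map_mkseq -induced_forget_signs.
apply/seteqP; split=> [x|x [e _ xe]]; rewrite /preimage /mkset through.
  move=> xp; set w := mkseq (sval x) (size p) in xp.
  (* The exponents are read off the play itself; the resulting word is reduced because it is a
     prefix of a play of [T']. *)
  have sw : size (map snd w) == size p by rewrite size_map size_mkseq.
  have zw : zip p (Tuple sw) = w by rewrite /= -{1}xp zip_unzip.
  exists (Tuple sw); rewrite /mkset zw; first exact: (svalP x).
  by rewrite /plays_through /mkset size_mkseq.
rewrite /plays_through /mkset size_zip size_tuple minnn in xe.
by rewrite xe [LHS]unzip1_zip // size_tuple.
Qed.

End Lift.

Theorem lemma6p3 (A : finType) (hA : 0 < #|A|) (Z : set (seq A)) :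
  let T := full_tree hA in
  let T' := reduced_tree hA in
  let W : set (play T) := \bigcup_(p in Z) plays_through T p in
  exists C : covering T' T,
    induced (cov_pi C) @^-1` W =
    \bigcup_(p in Z)
      \bigcup_(e in [set e : (size p).-tuple bool | reduced (zip p e)])
        plays_through T' (zip p e).
Proof.
move=> T T' W; exists (free_covering hA).
rewrite preimage_bigcup; apply: eq_bigcupr => p _.
exact: plays_through_forget_signs.
Qed.
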